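(* Let $f_\theta$ be an operator recurrent network on $\mathbb{R}^{n\times n}$ of depth $L$ with layerwise outputs $h_\ell=h_\ell(X)$, $\ell=0,\dots,L$. Then, for each $\ell$, there exists a countable collection of polynomial regions $\{U_i^\ell\}$ in $\mathbb{R}^{n\times n}$ satisfying: 1. This collection partitions $\mathbb{R}^{n\times n}$; that is, $U_i^\ell\cap U_j^\ell=\emptyset$ for every $i\ne j$, and $\bigcup_i\overline{U_i^\ell}=\mathbb{R}^{n\times n}$. 2. Every open ball $B\subset\mathbb{R}^{n\times n}$ only nontrivially intersects $U_i^\ell$ for finitely many $i$. 3. The restriction of $h_\ell$ to each $U_i^\ell$ is an operator polynomial of degree at most $\ell$, applied to $h_0$.
   Context: A (basic) operator recurrent network of depth $L$ and width $n$ with parameters $\theta$ is the function $f_\theta:\mathbb{R}^{n\times n}\to\mathbb{R}^n$, $f_\theta(X)=h_L$, where $h_0\in\mathbb{R}^n$ is an initial vector not depending on the input $X$ and, for $1\le\ell\le L$, $$h_\ell=b^{\ell,0}_\theta+A_\theta^{\ell,0}h_{\ell-1}+B_\theta^{\ell,0}Xh_{\ell-1}+\phi_\ell\big[b_\theta^{\ell,1}+A_\theta^{\ell,1}h_{\ell-1}+B_\theta^{\ell,1}Xh_{\ell-1}\big].$$ Here $b_\theta^{\ell,i}\in\mathbb{R}^n$ and $A_\theta^{\ell,i},B_\theta^{\ell,i}\in\mathbb{R}^{n\times n}$ ($i=0,1$) depend on $\theta$ but not on $X$, and the activation function $\phi_\ell:\mathbb{R}^n\to\mathbb{R}^n$ is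 a (leaky) rectifier acting componentwise as $y\mapsto\max(y,\eta y)$ with $0\le\eta\le1$ (possibly depending on $\ell$). An operator polynomial of degree $d$ on $\mathbb{R}^{n\times n}$ is a function $P:\mathbb{R}^{n\times n}\to\mathbb{R}^{n\times n}$ of the form $$P(X)=A_{00}+\sum_{j=1}^dA_{j0}\prod_{k=1}^j(XA_{jk})=A_{00}+A_{10}XA_{11}+A_{20}XA_{21}XA_{22}+\dots+A_{d0}X\cdots XA_{dd},$$ with matrix-valued coefficients $A_{jk}\in\mathbb{R}^{n\times n}$. ''Applied to $h_0$'' means that $h_\ell(X)=P(X)h_0$ for $X$ in the region, where $P$ is an operator polynomial. A polynomial region is an open subset $U\subset\mathbb{R}^{n\times n}$ such that for any boundary point $x_0\in\partial U$ there exist an open set $V$ containing $x_0$, a finite index set $J$, operator polynomials $P_j$ and vectors $v_j\in\mathbb{R}^n$ for $j\in J$, such that $$V\cap U=\{X\in V:(P_j(X)v_j)_1>0\text{ for all }j\in J\},$$ where $(\cdot)_1$ denotes the first component of a vector.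
   Formalization: Operator polynomials (also in polynomial regions) are taken as finite sums of the displayed form, since a single form is not closed under addition and item 3 then fails; and it is assumed that h_0 ≠ 0 or that all biases vanish, since for h_0 = 0 a bias can make h_1 nonzero while P(X)h_0 = 0. *)

(* Defs.v *)
From HB Require Import structures.
From mathcomp Require Import all_boot all_order all_algebra.
From mathcomp Require Import all_classical all_reals all_analysis.
Set Implicit Arguments.
Unset Strict Implicit.
Unset Printing Implicit Defensive.
Import Order.TTheory GRing.Theory Num.Theory.
Import numFieldNormedType.Exports.
Local Open Scope classical_set_scope.
Local Open Scope ring_scope.

Section Network.
Variables (R : realType) (n : nat).

Record layer := Layer {
  b0 : 'cV[R]_n; A0 : 'M[R]_n; B0 : 'M[R]_n;
  b1 : 'cV[R]_n; A1 : 'M[R]_n; B1 : 'M[R]_n;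
  slope : R;
  slope_ge0 : 0 <= slope;
  slope_le1 : slope <= 1 }.

Definition leaky_relu (eta y : R) : R := Num.max y (eta * y).

Definition layer_map (lay : layer) (X : 'M[R]_n) (h : 'cV[R]_n) : 'cV[R]_n :=
  b0 lay + A0 lay *m h + B0 lay *m X *m h
  + map_mx (leaky_relu (slope lay))
      (b1 lay + A1 lay *m h + B1 lay *m X *m h).

(* The weights are those obtained at one value of the parameter theta. *)
Record network (L : nat) := Network {
  h0 : 'cV[R]_n;
  layers : L.-tuple layer }.

(* [hidden N l X] is h_l(X); it is meant for l <= L. *)
Definition hidden L (N : network L) (l : nat) (X : 'M[R]_n) : 'cV[R]_n :=
  foldl (fun h lay => layer_map lay X h) (h0 N) (take l (layers N)).

Definition network_fun L (N : network L) (X : 'M[R]_n) : 'cV[R]_n :=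
  hidden N L X.

Definition bias_free L (N : network L) : Prop :=
  forall i : 'I_L, b0 (tnth (layers N) i) = 0 /\ b1 (tnth (layers N) i) = 0.

End Network.

Section PolynomialRegion.
Variables (R : realType) (n : nat).
Local Notation M := 'M[R]_n.+1.

(* A_00 + A_10 X A_11 + A_20 X A_21 X A_22 + ... + A_d0 X A_d1 ... X A_dd.
   The ring product of square matrices is *m, taken in increasing order of k. *)
Definition operator_form (d : nat) (A : nat -> nat -> M) (X : M) : M :=
  A 0%N 0%N + \sum_(1 <= j < d.+1) A j 0%N * \prod_(1 <= k < j.+1) (X * A j k).

(* Finite sums of operator forms. For n.+1 >= 2 a single form has only one
   monomial per degree, and such functions are not closed under addition:
   with S the matrix exchanging the two basis vectors of R^2, the map
   X |-> X e_1 + S X e_2 is not of the shape X |-> E X v. *)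
Definition operator_polynomial (d : nat) (P : M -> M) : Prop :=
  exists (m : nat) (A : 'I_m -> nat -> nat -> M),
    forall X, P X = \sum_(i < m) operator_form d (A i) X.

Definition boundary (U : set M) : set M := closure U `\` interior U.

Definition polynomial_region (U : set M) : Prop :=
  open U /\
  forall X0, boundary U X0 ->
    exists V : set M, [/\ open V, V X0 &
      exists (J : finType) (P : J -> M -> M) (v : J -> 'cV[R]_n.+1),
        (forall j, exists d, operator_polynomial d (P j)) /\
        V `&` U = [set X | V X /\ forall j, 0 < (P j X *m v j) ord0 ord0]].

End PolynomialRegion.

(* Main.v *)
Require Import Defs.
From HB Require Import structures.
From mathcomp Require Import all_boot all_order all_algebra.
From mathcomp Require Import all_classical all_reals all_analysis.
Import Order.TTheory GRing.Theory Num.Theory.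
Import numFieldNormedType.Exports.
Local Open Scope classical_set_scope.
Local Open Scope ring_scope.

(** By induction on the layer, there are finitely many disjoint cells, each cut
    out by finitely many strict polynomial inequalities, on each of which the
    layer output is an operator polynomial applied to the initial vector.  On a
    cell of layer l the argument of the next activation is Q(X) h_0 for a single
    operator polynomial Q of degree l + 1: the weights B X raise the degree by
    one, and the biases are matrix multiples of h_0 because h_0 is nonzero or
    they vanish.  The cell is split according to the signs of the components of
    Q(X) h_0, and on each piece the rectifier multiplies every component by 1 or
    by the slope, that is, it acts as a constant diagonal matrix
    ([piecewise_layer]).

    What is lost in the splitting is the union of the zero sets of those
    components that do not vanish identically.  The remaining points are dense:
    a set is called [generic] when it contains the nonvanishing locus of a
    polynomial function that is not identically zero.  Restricting polynomials
    to a line shows that generic sets form a filter ([generic_filter]) and that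
    they are dense ([generic_closure]).  A component that vanishes identically
    causes no loss, but both signs would then give the same piece; assigning it
    to the positive sign alone keeps the pieces disjoint ([sign_cell]).

    Since the number of cells is finite, local finiteness is immediate, and the
    closures of the cells cover the space because their union is dense. *)

(** * Algebra of operator polynomials *)

Section OperatorPolynomials.
Context {R : realType} {n : nat}.
Local Notation M := 'M[R]_n.+1.
Implicit Types (A : nat -> nat -> M) (P Q : M -> M) (C X : M) (d : nat).

(** Absorbing the constant term as the summand with an empty product makes the
    closure properties below uniform in the degree. *)
Lemma operator_formE d A X :
  operator_form d A X =
  \sum_(0 <= j < d.+1) A j 0%N * \prod_(1 <= k < j.+1) (X * A j k).
Proof. by rewrite big_ltn// [in RHS]big_geq// mulr1. Qed.

Lemma operator_polynomial_cst d C : operator_polynomial d (fun=> C).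
Proof.
exists 1%N, (fun _ j _ => if j == 0%N then C else 0) => X.
rewrite big_ord1 /operator_form eqxx big_nat big1 ?addr0// => j /andP[j0 _].
by rewrite gtn_eqF// mul0r.
Qed.

Lemma operator_polynomialD d P Q :
  operator_polynomial d P -> operator_polynomial d Q ->
  operator_polynomial d (fun X => P X + Q X).
Proof.
move=> [m [A PE]] [p [B QE]].
exists (m + p)%N, (fun i : 'I_(m + p) =>
  match fintype.split i with inl a => A a | inr b => B b end).
move=> X; rewrite PE QE big_split_ord/=.
by congr +%R; apply: eq_bigr => i _;
   rewrite ?(unsplitK (inl i)) ?(unsplitK (inr i)).
Qed.

Lemma operator_polynomial_mull d C P :
  operator_polynomial d P -> operator_polynomial d (fun X => C * P X).
Proof.
move=> [m [A PE]].
exists m, (fun i j k => if k == 0%N then C * A i j 0%N else A i j k) => X.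
rewrite PE mulr_sumr; apply: eq_bigr => i _.
rewrite !operator_formE mulr_sumr; apply: eq_bigr => j _.
rewrite eqxx -mulrA; congr (_ * (_ * _)).
by rewrite !big_nat; apply: eq_bigr => k /andP[k0 _]; rewrite gtn_eqF.
Qed.

Lemma operator_polynomial_weaken d P :
  operator_polynomial d P -> operator_polynomial d.+1 P.
Proof.
move=> [m [A PE]].
exists m, (fun i j k => if (j <= d)%N then A i j k else 0) => X.
rewrite PE; apply: eq_bigr => i _.
rewrite !operator_formE [RHS]big_nat_recr//= ltnn mul0r addr0.
rewrite !big_nat; apply: eq_bigr => j /andP[_]; rewrite ltnS => jd.
by rewrite jd.
Qed.

(** Left multiplication by X shifts the coefficients by one place, the freed
    leading coefficient being the identity: X A_0 X A_1 ... is 1 X A_0 X A_1 ... *)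
Lemma operator_polynomial_mulX d P :
  operator_polynomial d P -> operator_polynomial d.+1 (fun X => X * P X).
Proof.
move=> [m [A PE]].
exists m, (fun i j k => if j == 0%N then 0 else
                        if k == 0%N then 1 else A i j.-1 k.-1) => X.
rewrite PE mulr_sumr; apply: eq_bigr => i _.
rewrite !operator_formE mulr_sumr [RHS]big_nat_recl//= mul0r add0r.
apply: eq_bigr => j _; rewrite mul1r [in RHS]big_ltn// [in RHS]big_add1/= mulrA.
by congr (_ * _); rewrite !big_nat; apply: eq_bigr => k /andP[k0 _].
Qed.

End OperatorPolynomials.

(** * Polynomial functions and generic sets *)

Lemma exists_nonroot {F : idomainType} (q : {poly F}) (f : nat -> F) :
  q != 0 -> injective f -> exists i, q.[f i] != 0.
Proof.
move=> q0 finj; apply: contrapT => /forallNP qf.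
have rq : all (root q) [seq f i | i <- iota 0 (size q)].
  by apply/allP => _ /mapP[i _ ->]; apply/negPn/negP; exact: qf.
have := max_poly_roots q0 rq; rewrite map_inj_uniq// iota_uniq.
by rewrite size_map size_iota ltnn => /(_ isT).
Qed.

Section PolynomialFunctions.
Context {R : realType} {n : nat}.
Local Notation M := 'M[R]_n.+1.
Implicit Types (f g : M -> R) (F G : M -> M) (A B : set M).

(** Being polynomial along every line is all that the density argument uses;
    continuity serves for the openness of the regions. *)
Definition polyfun f : Prop :=
  continuous f /\
  forall X Y : M, exists q : {poly R}, forall t : R, f (X + t *: Y) = q.[t].

Lemma polyfun_cst (c : R) : polyfun (fun=> c).
Proof.
split=> [X|X Y]; first exact: cst_continuous.
by exists c%:P => t; rewrite hornerC.
Qed.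

Lemma polyfun_coord i j : polyfun (fun X => X i j).
Proof.
split=> [X|X Y]; first exact: coord_continuous.
by exists ((X i j)%:P + (Y i j)%:P * 'X) => t; rewrite !hornerE !mxE mulrC.
Qed.

Lemma polyfunD f g : polyfun f -> polyfun g -> polyfun (fun X => f X + g X).
Proof.
move=> [fc fp] [gc gp]; split=> [X|X Y]; first exact: (cvgD (fc X) (gc X)).
have [p pE] := fp X Y; have [q qE] := gp X Y.
by exists (p + q) => t; rewrite hornerD pE qE.
Qed.

Lemma polyfunM f g : polyfun f -> polyfun g -> polyfun (fun X => f X * g X).
Proof.
move=> [fc fp] [gc gp]; split=> [X|X Y]; first exact: (cvgM (fc X) (gc X)).
have [p pE] := fp X Y; have [q qE] := gp X Y.
by exists (p * q) => t; rewrite hornerM pE qE.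
Qed.

Lemma polyfun_sum {I : Type} (s : seq I) (f : I -> M -> R) :
  (forall i, polyfun (f i)) -> polyfun (fun X => \sum_(i <- s) f i X).
Proof.
move=> fP; elim: s => [|i s IH].
  rewrite (_ : (fun=> _) = fun=> 0); first exact: polyfun_cst.
  by apply/funext => X; rewrite big_nil.
rewrite (_ : (fun=> _) = fun X => f i X + \sum_(k <- s) f k X).
  exact: polyfunD.
by apply/funext => X; rewrite big_cons.
Qed.

Definition mxpolyfun F : Prop := forall i j, polyfun (fun X => F X i j).

Lemma mxpolyfun_cst (C : M) : mxpolyfun (fun=> C).
Proof. by move=> i j; exact: polyfun_cst. Qed.

Lemma mxpolyfunM F G :
  mxpolyfun F -> mxpolyfun G -> mxpolyfun (fun X => F X * G X).
Proof.
move=> FP GP i j.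
rewrite (_ : (fun=> _) = fun X => \sum_k F X i k * G X k j).
  by apply: polyfun_sum => k; exact: polyfunM.
by apply/funext => X; rewrite mxE.
Qed.

Lemma mxpolyfun_sum {I : Type} (s : seq I) (F : I -> M -> M) :
  (forall i, mxpolyfun (F i)) -> mxpolyfun (fun X => \sum_(i <- s) F i X).
Proof.
move=> FP i j.
rewrite (_ : (fun=> _) = fun X => \sum_(k <- s) F k X i j).
  by apply: polyfun_sum => k; exact: FP.
by apply/funext => X; rewrite summxE.
Qed.

Lemma mxpolyfun_prod {I : Type} (s : seq I) (F : I -> M -> M) :
  (forall i, mxpolyfun (F i)) -> mxpolyfun (fun X => \prod_(i <- s) F i X).
Proof.
move=> FP; elim: s => [|i s IH].
  rewrite (_ : (fun=> _) = fun=> 1); first exact: mxpolyfun_cst.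
  by apply/funext => X; rewrite big_nil.
rewrite (_ : (fun=> _) = fun X => F i X * \prod_(k <- s) F k X).
  exact: mxpolyfunM.
by apply/funext => X; rewrite big_cons.
Qed.

Lemma operator_polynomial_mxpolyfun d F :
  operator_polynomial d F -> mxpolyfun F.
Proof.
move=> [m [A FE]].
rewrite (_ : F = fun X => \sum_(i < m) operator_form d (A i) X).
  2: exact/funext.
apply: mxpolyfun_sum => i.
rewrite (_ : operator_form d (A i) = fun X => \sum_(0 <= j < d.+1)
    A i j 0%N * \prod_(1 <= k < j.+1) (X * A i j k)).
  apply: mxpolyfun_sum => j; apply: mxpolyfunM; first exact: mxpolyfun_cst.
  apply: mxpolyfun_prod => k; apply: mxpolyfunM; last exact: mxpolyfun_cst.
  exact: polyfun_coord.
by apply/funext => X; rewrite operator_formE.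
Qed.

(** The nonvanishing loci here are the basic Zariski open sets, so this is the
    filter of sets with nonempty Zariski interior. *)
Definition generic : set_system M := [set A | exists2 g, polyfun g &
  (exists Z, g Z != 0) /\ forall X, g X != 0 -> A X].

(** Two nonzero polynomials f and g have a common nonvanishing point on the line
    through a point where f is nonzero and one where g is nonzero: both
    restrict to nonzero univariate polynomials, whose product has finitely many
    roots. *)
#[global] Instance generic_filter : Filter generic.
Proof.
split.
- exists (fun=> 1); first exact: polyfun_cst.
  by split=> //; exists 0; exact: oner_neq0.
- move=> A B [f fP [[Y fY] fA]] [g gP [[Z gZ] gB]].
  exists (fun X => f X * g X); first exact: polyfunM.
  split; last by move=> X; rewrite mulf_eq0 negb_or => /andP[/fA ? /gB].
  have [p pE] := fP.2 Y (Z - Y); have [q qE] := gP.2 Y (Z - Y).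
  have p0 : p != 0.
    by apply: contraNneq fY => p0;
       rewrite -[Y]addr0 -(scale0r (Z - Y)) pE p0 horner0.
  have q0 : q != 0.
    by apply: contraNneq gZ => q0;
       rewrite -[Z](subrKC Y) -(scale1r (Z - Y)) qE q0 horner0.
  have pq0 : p * q != 0 by rewrite mulf_neq0.
  have [i pqi] := exists_nonroot _ _ pq0 (mulrIn (oner_neq0 R)).
  exists (Y + i%:R *: (Z - Y)).
  by rewrite pE qE -hornerM.
- move=> A B AB [g gP [gZ gA]]; exists g => //; split=> // X /gA; exact: AB.
Qed.

(** Join X to a point Z with g Z != 0: along this line g has finitely many zeros,
    hence it is nonzero at points arbitrarily close to X. *)
Lemma generic_closure A : generic A -> closure A = setT.
Proof.
move=> [g gP [[Z gZ] gA]]; apply/seteqP; split=> // X _ B XB.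
have [p pE] := gP.2 X (Z - X).
have p0 : p != 0.
  by apply: contraNneq gZ => p0;
     rewrite -[Z](subrKC X) -(scale1r (Z - X)) pE p0 horner0.
have : \forall t \near (0 : R), B (X + t *: (Z - X)).
  have : X + t *: (Z - X) @[t --> (0 : R)] --> X + 0 *: (Z - X).
    by apply: cvgD; [exact: cvg_cst|exact: scalel_continuous].
  by rewrite scale0r addr0 => /(_ _ XB).
move=> /nbhs_norm0P[e/= e0 eB].
(* The shift by 2 makes all these parameters strictly smaller than e. *)
have inj : injective (fun i : nat => e / i.+2%:R).
  move=> i j /(mulfI (lt0r_neq0 e0))/invr_inj/(mulrIn (oner_neq0 R)).
  by case.
have [i pi] := exists_nonroot _ _ p0 inj.
exists (X + (e / i.+2%:R) *: (Z - X)); split; first by apply: gA; rewrite pE.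
apply: eB => /=; rewrite ger0_norm ?divr_ge0 ?ltW//.
by rewrite ltr_pdivrMr// ltr_pMr// ltr1n.
Qed.

Lemma generic_neq0 f : polyfun f -> (exists Z, f Z != 0) ->
  generic [set X | f X != 0].
Proof. by move=> fP fZ; exists f. Qed.

Lemma closure_bigcup_generic {I : finType} (U : I -> set M) :
  generic (\bigcup_i U i) -> \bigcup_i closure (U i) = setT.
Proof.
move=> UG; apply/seteqP; split=> // X _; apply: contrapT => XU.
have : \forall Y \near X, forall i, ~ U i Y.
  apply: (filter_forall (F := nbhs X)) => i; apply: contrapT => Xi; case: XU.
  exists i => // B XB; apply: contrapT => UB; apply: Xi.
  by apply: filterS XB => Y BY UY; apply: UB; exists Y.
move=> XV; have : closure (\bigcup_i U i) X by rewrite generic_closure.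
by move=> /(_ _ XV) [Y [[i _ UY]]] /(_ i).
Qed.

End PolynomialFunctions.

(** * Regions defined by strict polynomial inequalities *)

Section BasicRegions.
Context {R : realType} {n : nat}.
Local Notation M := 'M[R]_n.+1.
Implicit Types (y : M -> R) (U V : set M).

(** The quantities (P(X) v)_1 whose signs define polynomial regions. *)
Definition test_function y : Prop := exists d P (v : 'cV[R]_n.+1),
  operator_polynomial d P /\ forall X, y X = (P X *m v) ord0 ord0.

Definition basic_region U : Prop :=
  exists (J : finType) (y : J -> M -> R), (forall j, test_function (y j)) /\
    U = [set X | forall j, 0 < y j X].

Lemma test_function_polyfun y : test_function y -> polyfun y.
Proof.
move=> [d [P [v [PP yE]]]].
rewrite (_ : y = fun X => \sum_k P X ord0 k * v k ord0).
  apply: polyfun_sum => k; apply: polyfunM; last exact: polyfun_cst.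
  exact: (operator_polynomial_mxpolyfun _ _ PP).
by apply/funext => X; rewrite yE mxE.
Qed.

(** Regions only test first components, but left multiplication by a matrix unit
    brings any component there. *)
Lemma test_function_entry d P (v : 'cV[R]_n.+1) k :
  operator_polynomial d P -> test_function (fun X => (P X *m v) k ord0).
Proof.
move=> PP; exists d, (fun X => delta_mx ord0 k * P X), v; split.
  exact: operator_polynomial_mull.
move=> X; rewrite -mulmxE -mulmxA [RHS]mxE (bigD1 k)//=.
rewrite [delta_mx _ _ _ _]mxE !eqxx mul1r big1 ?addr0// => j jk.
by rewrite [delta_mx _ _ _ _]mxE (negPf jk) andbF mul0r.
Qed.

Lemma test_functionN y : test_function y -> test_function (fun X => - y X).
Proof.
move=> [d [P [v [PP yE]]]]; exists d, P, (- v); split=> // X.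
by rewrite yE mulmxN [in RHS]mxE.
Qed.

(** The inequalities hold globally, so the same ones describe the region near
    every boundary point. *)
Lemma polynomial_region_basic U : basic_region U -> polynomial_region U.
Proof.
move=> [J [y [yT ->]]]; split.
  rewrite openE => X /= yX; rewrite /interior.
  apply: (filter_forall (F := nbhs X)) => j; apply: (cvgr_gt _ _ _ (yX j)).
  by have [+ _] := test_function_polyfun _ (yT j); exact.
move=> X0 _; exists setT; split; [exact: openT|by []|].
have /choice[d /choice[P /choice[v PE]]] := yT.
exists J, P, v; split=> [j|]; first by exists (d j); exact: (PE j).1.
rewrite setTI; apply/seteqP; split=> X /=.
  by move=> yX; split=> // j; rewrite -(PE j).2.
by move=> [_ yX] j; rewrite (PE j).2.
Qed.

Lemma basic_regionT : basic_region setT.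
Proof.
exists void, (fun=> cst 0); split=> [[]|].
by apply/seteqP; split=> // X _ [].
Qed.

Lemma basic_regionI U V :
  basic_region U -> basic_region V -> basic_region (U `&` V).
Proof.
move=> [J [y [yT ->]]] [K [z [zT ->]]].
exists (J + K)%type, (fun i => match i with inl j => y j | inr k => z k end).
split=> [[]//|]; apply/seteqP; split=> X /=.
  by move=> [yX zX] [].
by move=> h; split=> [j|k]; [exact: (h (inl j))|exact: (h (inr k))].
Qed.

Lemma basic_region_forall {I : finType} (U : I -> set M) :
  (forall i, basic_region (U i)) -> basic_region [set X | forall i, U i X].
Proof.
move=> UB.
suff: forall s : seq I, basic_region [set X | forall i, i \in s -> U i X].
  move=> /(_ (enum I)); congr basic_region; apply/seteqP; split=> X /= XU i.
    by apply: XU; rewrite mem_enum.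
  by move=> _; exact: XU.
elim=> [|i s IH].
  by have := basic_regionT; congr basic_region; apply/seteqP; split.
have := basic_regionI _ _ (UB i) IH; congr basic_region.
apply/seteqP; split=> X /=.
  by move=> [Xi Xs] k; rewrite inE => /predU1P[->//|/Xs].
move=> h; split; first by apply: h; rewrite mem_head.
by move=> k ks; apply: h; rewrite inE ks orbT.
Qed.

Lemma basic_region_gt0 y : test_function y -> basic_region [set X | 0 < y X].
Proof.
move=> yT; exists unit, (fun=> y); split=> //.
by apply/seteqP; split=> [X yX|X /(_ tt)].
Qed.

(** A function that vanishes identically is counted as positive, so that the two
    cells are disjoint while their union is generic for every polynomial. *)
Definition sign_cell y (s : bool) : set M :=
  if s then [set X | 0 < y X \/ forall Z, y Z = 0] else [set X | y X < 0].

Lemma basic_region_sign_cell y s :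
  test_function y -> basic_region (sign_cell y s).
Proof.
move=> yT; case: s => /=; last first.
  have := basic_region_gt0 _ (test_functionN _ yT); congr basic_region.
  by apply/seteqP; split=> X /=; rewrite oppr_gt0.
have [y0|y0] := pselect (forall Z, y Z = 0).
  have := basic_regionT; congr basic_region.
  by apply/seteqP; split=> // X; right.
have := basic_region_gt0 _ yT; congr basic_region.
by apply/seteqP; split=> X /=; [left|case].
Qed.

Lemma sign_cell_inj y s1 s2 X :
  sign_cell y s1 X -> sign_cell y s2 X -> s1 = s2.
Proof.
have disj : sign_cell y true X -> ~ sign_cell y false X.
  by rewrite /= => -[/lt_gtF->|->]; rewrite ?ltxx.
by case: s1 s2 => [] [] // => [/disj|/[swap] /disj].
Qed.

(** The complement of the two cells is the zero set of y, or is empty when y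
    vanishes identically. *)
Lemma generic_sign_cell y :
  polyfun y -> generic [set X | exists s, sign_cell y s X].
Proof.
move=> yP; have [y0|/existsNP[Z /eqP yZ]] := pselect (forall Z, y Z = 0).
  by apply: (filterS _ filterT) => X _; exists true; right.
apply: filterS (generic_neq0 _ yP (ex_intro _ Z yZ)) => X /=.
by case: ltgtP => // y0 _; [exists false|exists true; left].
Qed.

Lemma leaky_relu_sign_cell (eta : R) y s X :
  0 <= eta -> eta <= 1 -> sign_cell y s X ->
  leaky_relu eta (y X) = (if s then 1 else eta) * y X.
Proof.
move=> eta0 eta1; rewrite /leaky_relu; case: s => /= yX.
  rewrite mul1r max_l// ler_piMl//.
  by case: yX => [/ltW//|->].
by rewrite max_r// ler_niMl//; exact: ltW.
Qed.

End BasicRegions.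

(** * Propagation through the layers *)

Section Network.
Context {R : realType} {n : nat}.
Local Notation M := 'M[R]_n.+1.
Implicit Types (v b : 'cV[R]_n.+1) (h : M -> 'cV[R]_n.+1).

(** The induction hypothesis on the layers: finitely many cells, with generic
    rather than merely dense union, because genericity survives the finite
    intersections that refining the cells requires. *)
Definition piecewise_operator_polynomial d v h : Prop :=
  exists (I : finType) (U : I -> set M) (P : I -> M -> M),
    [/\ forall i, basic_region (U i),
        forall i j X, U i X -> U j X -> i = j,
        generic (\bigcup_i U i),
        forall i, operator_polynomial d (P i)
      & forall i X, U i X -> h X = P i X *m v].

Lemma piecewise_cst v : piecewise_operator_polynomial 0 v (fun=> v).
Proof.
exists unit, (fun=> setT), (fun _ _ => 1); split=> //.
- by move=> _; exact: basic_regionT.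
- by move=> [] [].
- by apply: (filterS _ filterT) => X _; exists tt.
- by move=> _; exact: operator_polynomial_cst.
- by move=> _ X _; rewrite mul1mx.
Qed.

(** A bias is an operator polynomial of degree 0 applied to v: if v_k is nonzero,
    take the matrix whose k-th column is b / v_k and whose other columns are 0. *)
Lemma exists_mulmx_cV v b : v <> 0 \/ b = 0 -> exists C : M, b = C *m v.
Proof.
move=> [/eqP/cV0Pn[k vk]|->]; last by exists 0; rewrite mul0mx.
exists ((v k 0)^-1 *: (b *m delta_mx 0 k)).
rewrite -scalemxAl -mulmxA -rowE; apply/colP => i.
by rewrite !mxE big_ord1 mxE mulrCA mulVf ?mulr1.
Qed.

(** Each cell is refined by the sign patterns of the components of the activation
    argument; for the pattern s the activation is the diagonal matrix [D s]. *)
Lemma piecewise_layer d v h (lay : layer R n.+1) :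
  v <> 0 \/ (b0 lay = 0 /\ b1 lay = 0) ->
  piecewise_operator_polynomial d v h ->
  piecewise_operator_polynomial d.+1 v (fun X => layer_map lay X (h X)).
Proof.
move=> hv [I [U [P [UB Uinj UG PP hP]]]].
have [C0 b0E] : exists C, b0 lay = C *m v by apply: exists_mulmx_cV; tauto.
have [C1 b1E] : exists C, b1 lay = C *m v by apply: exists_mulmx_cV; tauto.
pose aff (C A B : M) i X : M := C + A * P i X + B * (X * P i X).
have affP C A B i : operator_polynomial d.+1 (aff C A B i).
  apply: operator_polynomialD.
    2: exact/operator_polynomial_mull/operator_polynomial_mulX.
  apply: operator_polynomialD; first exact: operator_polynomial_cst.
  exact/operator_polynomial_mull/operator_polynomial_weaken.
have affE C A B i X : U i X ->
    aff C A B i X *m v = C *m v + A *m h X + B *m X *m h X.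
  by move=> /hP ->; rewrite /aff -!mulmxE !mulmxDl !mulmxA.
pose y i k X := (aff C1 (A1 lay) (B1 lay) i X *m v) k ord0.
have yT i k : test_function (y i k) by exact: test_function_entry.
pose D (s : {ffun 'I_n.+1 -> bool}) : M :=
  diag_mx (\row_k if s k then 1 else slope lay).
exists (I * {ffun 'I_n.+1 -> bool})%type,
  (fun c : I * {ffun 'I_n.+1 -> bool} =>
     U c.1 `&` [set X | forall k, sign_cell (y c.1 k) (c.2 k) X]),
  (fun (c : I * {ffun 'I_n.+1 -> bool}) X => aff C0 (A0 lay) (B0 lay) c.1 X
               + D c.2 * aff C1 (A1 lay) (B1 lay) c.1 X); split.
- move=> [i s]/=; apply: basic_regionI => //.
  by apply: basic_region_forall => k; exact: basic_region_sign_cell.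
- move=> [i s] [j t] X /= [Xi Xs] [Xj Xt].
  have ij := Uinj _ _ _ Xi Xj; rewrite -{}ij in Xt *.
  congr pair; apply/ffunP => k; exact: sign_cell_inj (Xs k) (Xt k).
- have SG : generic [set X | forall i k, exists s, sign_cell (y i k) s X].
    apply: (filter_forall (F := generic)) => i.
    apply: (filter_forall (F := generic)) => k.
    exact/generic_sign_cell/test_function_polyfun.
  apply: filterS (filterI UG SG) => X [[i _ Xi] /(_ i)/choice[s Xs]].
  by exists (i, [ffun k => s k]) => //=; split=> // k; rewrite ffunE.
- move=> [i s]/=; apply: operator_polynomialD => //.
  exact: operator_polynomial_mull.
- move=> [i s] X /= [Xi Xs]; rewrite /layer_map mulmxDl.
  rewrite (affE _ _ _ _ _ Xi) -b0E -mulmxE -(mulmxA (D s)); congr (_ + _).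
  rewrite b1E -(affE _ _ _ _ _ Xi) mul_diag_mx; apply/colP => k.
  rewrite [LHS]mxE [RHS]mxE [X in X * _]mxE.
  exact: leaky_relu_sign_cell (slope_ge0 lay) (slope_le1 lay) (Xs k).
Qed.

Lemma piecewise_hidden L (N : network R n.+1 L) (l : nat) :
  h0 N <> 0 \/ bias_free N -> (l <= L)%N ->
  piecewise_operator_polynomial l (h0 N) (hidden N l).
Proof.
move=> hN; elim: l => [_|l IH lL].
  by rewrite /hidden take0; exact: piecewise_cst.
pose lay := tnth (layers N) (Ordinal lL).
have -> : hidden N l.+1 = fun X => layer_map lay X (hidden N l X).
  apply/funext => X; rewrite /hidden (take_nth lay) ?size_tuple// -cats1.
  by rewrite foldl_cat/= [lay in RHS](tnth_nth lay).
apply: piecewise_layer; last exact/IH/ltnW.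
by case: hN => [|/(_ (Ordinal lL))]; [left|right].
Qed.

End Network.

Theorem theorem2p4 (R : realType) (n L : nat) (N : network R n.+1 L)
    (hN : h0 N <> 0 \/ bias_free N) (l : nat) (hl : (l <= L)%N) :
  exists (I : countType) (U : I -> set 'M[R]_n.+1),
    [/\ forall i, polynomial_region (U i),
        (forall i j, i <> j -> U i `&` U j = set0)
          /\ \bigcup_i closure (U i) = setT,
        forall (X : 'M[R]_n.+1) (r : R), 0 < r ->
          finite_set [set i | ball X r `&` U i !=set0]
      & forall i, exists (d : nat) (P : 'M[R]_n.+1 -> 'M[R]_n.+1),
          [/\ (d <= l)%N, operator_polynomial d P
            & {in U i, forall X, hidden N l X = P X *m h0 N}]].
Proof.
have [I [U [P [UB Uinj UG PP hP]]]] := piecewise_hidden _ _ _ hN hl.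
exists I, U; split.
- by move=> i; exact: polynomial_region_basic.
- split; last exact: closure_bigcup_generic.
  by move=> i j ij; apply/seteqP; split=> // X [Xi /(Uinj _ _ _ Xi)].
- by move=> X r _; exact: finite_finset.
- move=> i; exists l, (P i); split=> // X; rewrite inE; exact: hP.
Qed.
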